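(* Let $D$ be an integral domain, let $\star$ be a semistar operation on $D$, and let $m\ge1$ be an integer. Then $$\star[X_1,\cdots,X_m]\text{-}\dim_v(D[X_1,\cdots,X_m])=\widetilde{\star}\text{-}\dim_v(D)+m.$$
   Context: For a domain $D$ with quotient field $K$, $\overline{\mathcal F}(D)$ is the set of nonzero $D$-submodules of $K$ and $f(D)$ the set of nonzero finitely generated $D$-submodules of $K$. A semistar operation on $D$ is a map $\star:\overline{\mathcal F}(D)\to\overline{\mathcal F}(D)$, $E\mapsto E^\star$, such that for all $0\ne x\in K$ and $E,F\in\overline{\mathcal F}(D)$: $(xE)^\star=xE^\star$; $E\subseteq F$ implies $E^\star\subseteq F^\star$; $E\subseteq E^\star=(E^\star)^\star$. Define $E^{\star_f}:=\bigcup\{F^\star\mid F\in f(D),F\subseteq E\}$. A nonzero ideal $I$ of $D$ is a quasi-$\star$-ideal if $I^\star\cap D=I$; $\operatorname{QMax}^{\star}(D)$ is the set of maximal elements of the set of proper quasi-$\star$-ideals (they are prime). $\widetilde\star$ is the semistar operation $E^{\widetilde\star}:=\bigcap\{ED_P\mid P\in\operatorname{QMax}^{\star_f}(D)\}$ (equal to $K$ if $\operatorname{QMax}^{\star_f}(D)=\emptyset$). A valuation overring $V$ of $D$, i.e. a valuation domain with $D\subseteq V\subseteq K$ ($V=K$ allowed, of dimension $0$), is a $\star$-valuation overring if $F^\star\subseteq FV$ for each $F\in f(D)$. $\star\text{-}\dim_v(D)=n$ means every $\star$-valuation overring of $D$ has dimension at most $n$ and some $\star$-valuation overring has dimension $n$;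 if no such integer exists, $\star\text{-}\dim_v(D)=\infty$. Convention: $\infty+m=\infty$. Let $X,Y$ be indeterminates, $D_1:=D[X]$, $K_1:=K(X)$, $\Theta_1^{\star}:=\{Q\in\operatorname{Spec}(D_1)\mid Q\cap D=(0)\text{ or }(Q\cap D)^{\star_f}\subsetneq D^{\star}\}$, $\mathfrak S_1^\star:=D_1[Y]\setminus\bigcup\{Q[Y]\mid Q\in\Theta_1^\star\}$. The semistar operation $\star[X]$ on $D[X]$ is defined by $E^{\star[X]}:=E[Y]_{\mathfrak S_1^\star}\cap K_1$ for $E\in\overline{\mathcal F}(D_1)$. For $r\ge2$, $\star[X_1,\cdots,X_r]:=(\star[X_1,\cdots,X_{r-1}])[X_r]$, a semistar operation on $D[X_1,\cdots,X_r]$. *)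

(* Defs.v *)
From HB Require Import structures.
From mathcomp Require Import all_boot all_order all_algebra.
From mathcomp Require Import boolp classical_sets.

Set Implicit Arguments.
Unset Strict Implicit.
Unset Printing Implicit Defensive.

Import GRing.Theory.
Local Open Scope ring_scope.
Local Open Scope classical_set_scope.

Notation "x %:F" := (@FracField.tofrac _ x) : ring_scope.

(* Ideals of a subring [A] of a commutative ring [R], as subsets of [R].
   [A := setT] gives the ideals of [R] itself; the general case is used for the
   overrings of a domain, which are subsets of its quotient field. *)
Section Ideals.
Variable R : comNzRingType.
Implicit Types A I P : set R.

Definition ideal A I : Prop :=
  [/\ I `<=` A, I 0, forall x y, I x -> I y -> I (x + y)
    & forall a x, A a -> I x -> I (a * x)].

Definition prime_ideal A P : Prop :=
  [/\ ideal A P, ~ P 1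
    & forall x y, A x -> A y -> P (x * y) -> P x \/ P y].

(* The indices of a chain of length n are 0, ..., n; the values of [P] beyond
   n are irrelevant. *)
Definition has_prime_chain A (n : nat) : Prop :=
  exists P : nat -> set R,
    (forall i, (i <= n)%N -> prime_ideal A (P i)) /\
    (forall i, (i < n)%N -> P i `<` P i.+1).

Definition krull_dim_le A (n : nat) : Prop :=
  forall k, has_prime_chain A k -> (k <= n)%N.

Definition krull_dim_eq A (n : nat) : Prop :=
  krull_dim_le A n /\ has_prime_chain A n.

Definition coef_in (E : set R) : set {poly R} :=
  [set p | p \is a polyOver [in E]].

End Ideals.

Section Semistar.
Variable D : idomainType.
Local Notation K := {fraction D}.
Implicit Types (E F V : set K) (I J P : set D).

Definition frac_image I : set K := [set d%:F | d in I].

Definition submodule E : Prop :=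
  [/\ E 0, forall x y, E x -> E y -> E (x + y)
    & forall (d : D) x, E x -> E (d%:F * x)].

Definition nonzero_submodule E : Prop :=
  submodule E /\ exists2 x, E x & x != 0.

Definition span (n : nat) (g : 'I_n -> K) : set K :=
  [set x | exists d : 'I_n -> D, x = \sum_(i < n) (d i)%:F * g i].

Definition nonzero_fg_submodule F : Prop :=
  (exists2 x, F x & x != 0) /\
  exists (n : nat) (g : 'I_n -> K), F = span g.

Definition scale_set (x : K) E : set K := [set x * e | e in E].

(* The product EF, i.e. the finite sums of products ef. *)
Definition prod_mod E F : set K :=
  [set x | exists (n : nat) (e f : 'I_n -> K),
     (forall i, E (e i) /\ F (f i)) /\ x = \sum_(i < n) e i * f i].

(* Only the values on nonzero submodules are constrained: a semistar operation
   is represented by any map on subsets of K that extends it. *)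
Definition is_semistar (star : set K -> set K) : Prop :=
  [/\ forall E, nonzero_submodule E -> nonzero_submodule (star E),
      forall (x : K) E, x != 0 -> nonzero_submodule E ->
        star (scale_set x E) = scale_set x (star E),
      forall E F, nonzero_submodule E -> nonzero_submodule F ->
        E `<=` F -> star E `<=` star F
    & forall E, nonzero_submodule E ->
        E `<=` star E /\ star (star E) = star E].

Variable star : set K -> set K.

Definition star_f E : set K :=
  \bigcup_(F in [set F | nonzero_fg_submodule F /\ F `<=` E]) star F.

Definition quasi_star_ideal I : Prop :=
  [/\ ideal setT I, exists2 d, I d & d != 0
    & [set d : D | star (frac_image I) d%:F] = I].

Definition proper_quasi_star_ideal I : Prop :=
  quasi_star_ideal I /\ I <> setT.

Definition QMax : set (set D) :=
  [set I | proper_quasi_star_ideal I /\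
     forall J, proper_quasi_star_ideal J -> I `<=` J -> J = I].

Definition localization P : set K :=
  [set x | exists a s : D, ~ P s /\ x = a%:F / s%:F].

(* [D] is contained in [V], so the quotient field of [V] is K. *)
Definition valuation_overring V : Prop :=
  [/\ frac_image setT `<=` V, GRing.subring_closed [in V]
    & forall x : K, x != 0 -> V x \/ V x^-1].

Definition star_valuation_overring V : Prop :=
  valuation_overring V /\
  forall F, nonzero_fg_submodule F -> star F `<=` prod_mod F V.

Definition star_dimv_eq (n : nat) : Prop :=
  (forall V, star_valuation_overring V -> krull_dim_le V n) /\
  exists2 V, star_valuation_overring V & krull_dim_eq V n.

(* [None] stands for infinity. *)
Definition star_dimv : option nat :=
  xget None [set Some n | n in [set n | star_dimv_eq n]].

End Semistar.

Definition star_tilde (D : idomainType)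
    (star : set {fraction D} -> set {fraction D}) (E : set {fraction D}) :
    set {fraction D} :=
  \bigcap_(P in QMax (star_f star)) prod_mod E (localization P).

Section StarPoly.
Variables (D : idomainType) (star : set {fraction D} -> set {fraction D}).
Local Notation D1 := {poly D}.
Local Notation K1 := {fraction {poly D}}.

Definition Theta1 : set (set D1) :=
  [set Q | prime_ideal setT Q /\
     let QD : set D := [set d | Q d%:P] in
     QD = [set 0] \/
     star_f star (frac_image QD) `<` star (frac_image setT)].

Definition frakS1 : set {poly D1} := ~` \bigcup_(Q in Theta1) coef_in Q.

(* E[Y] localized at [frakS1], inside K_1(Y) = Frac(K_1[Y]). *)
Definition poly_localization (E : set K1) : set {fraction {poly K1}} :=
  [set z | exists (e : {poly K1}) (s : {poly D1}),
     [/\ coef_in E e, frakS1 s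
       & z = e%:F / (map_poly (@FracField.tofrac D1) s)%:F]].

Definition star_poly (E : set K1) : set K1 :=
  [set x | poly_localization E (x%:P)%:F].

End StarPoly.

(* D[X_1, ..., X_r] = D[X_1, ..., X_{r-1}][X_r]. *)
Fixpoint iter_poly (D : idomainType) (r : nat) : idomainType :=
  if r is r'.+1 then {poly iter_poly D r'} else D.

Fixpoint star_iter_poly (D : idomainType)
    (star : set {fraction D} -> set {fraction D}) (r : nat) {struct r} :
    set {fraction (iter_poly D r)} -> set {fraction (iter_poly D r)} :=
  match r return set {fraction (iter_poly D r)} -> set {fraction (iter_poly D r)} with
  | 0%N => star
  | r'.+1 => star_poly (@star_iter_poly D star r')
  end.
Arguments star_iter_poly {D} star r _.

(* Addition with a natural number in the naturals extended by infinity. *)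
Definition dim_add (d : option nat) (m : nat) : option nat :=
  omap (addn^~ m) d.

(* Main.v *)
Require Import Defs.
From HB Require Import structures.
From mathcomp Require Import all_boot all_order all_algebra.
From mathcomp Require Import ring zify.
From mathcomp Require Import boolp classical_sets.

(* A valuation overring V of D is a (star tilde)-valuation overring iff its
   center Q on D satisfies 1 \notin Q^{star_f}, because an ideal with that
   property lies in some member of QMax^{star_f}(D). Likewise W is a
   star[X]-valuation overring of D[X] iff the center of W on D has that property:
   if F = (a_0, ..., a_n) lies in the center and 1 \in F^star, then
   a_0 + a_1 Y + ... + a_n Y^n lies in the multiplicative set defining star[X].
   So W is a star[X]-valuation overring iff W \cap K is a (star tilde)-valuation
   overring, and such W are also exactly the (star[X] tilde)-valuation overrings,
   which gives the induction on the number of indeterminates.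
   In passing from W to W \cap K a chain of primes loses at most one link, as
   two elements of K(X) are algebraically dependent over K. Conversely V is the
   trace on K of the ring of rational functions regular at 0 with value at 0 in
   V, whose primes are 0 and the preimages of the primes of V. *)

Set Implicit Arguments.
Unset Strict Implicit.
Unset Printing Implicit Defensive.

Import GRing.Theory.
Local Open Scope ring_scope.
Local Open Scope classical_set_scope.
Local Open Scope quotient_scope.

(** * Elements of the fraction field as quotients *)

Lemma frac_repr (D : idomainType) (x : {fraction D}) :
  x = (\n_(repr x))%:F / (\d_(repr x))%:F.
Proof.
have y20 := denom_ratioP (repr x).
apply: (@mulIf _ (\d_(repr x))%:F); first by rewrite tofrac_eq0.
rewrite mulfVK ?tofrac_eq0 // -[X in X * _]reprK; unlock FracField.tofrac.
rewrite -[LHS]FracField.pi_mul; apply/eqmodP.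
rewrite /= FracField.equivfE /FracField.mulf /=.
by rewrite !numden_Ratio ?mulr1 ?oner_neq0 // mulrC.
Qed.

Lemma fracP (D : idomainType) (x : {fraction D}) :
  exists a b : D, b != 0 /\ x = a%:F / b%:F.
Proof.
by exists (\n_(repr x)), (\d_(repr x)); rewrite denom_ratioP -frac_repr.
Qed.

(** * Valuation rings of a field and their prime ideals *)

Section ValuationRings.
Variable F : fieldType.
Implicit Types V P : set F.

Definition valuation_ring V : Prop :=
  GRing.subring_closed [in V] /\ forall x : F, x != 0 -> V x \/ V x^-1.

(* For a valuation ring V this is its maximal ideal: if V does not contain
   x^-1 then it contains x. *)
Definition nonunits V : set F := [set x | x = 0 \/ ~ V x^-1].

Variable V : set F.
Hypothesis valV : valuation_ring V.

Lemma vring1 : V 1.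
Proof. by case: valV => -[+ _ _] _; rewrite inE. Qed.

Lemma vringB x y : V x -> V y -> V (x - y).
Proof. by case: valV => -[_ + _] _; move=> /(_ x y); rewrite !inE. Qed.

Lemma vringM x y : V x -> V y -> V (x * y).
Proof. by case: valV => -[_ _ +] _; move=> /(_ x y); rewrite !inE. Qed.

Lemma vring0 : V 0.
Proof. by rewrite -(subrr 1); apply: vringB; apply: vring1. Qed.

Lemma vringN x : V x -> V (- x).
Proof. by move=> Vx; rewrite -sub0r; apply: vringB => //; apply: vring0. Qed.

Lemma vringD x y : V x -> V y -> V (x + y).
Proof. by move=> Vx Vy; rewrite -[y]opprK; apply/vringB/vringN. Qed.

Lemma vringX x n : V x -> V (x ^+ n).
Proof.
by move=> Vx; elim: n => [|n IH]; [apply: vring1|rewrite exprS; apply: vringM].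
Qed.

Lemma vring_total x : x != 0 -> V x \/ V x^-1.
Proof. by case: valV => _; apply. Qed.

Lemma nonunits_sub x : nonunits V x -> V x.
Proof.
case=> [->|nVx]; first exact: vring0.
by have [->|/vring_total[]//] := eqVneq x 0; apply: vring0.
Qed.

Lemma unit_vringV x : ~ nonunits V x -> V x^-1.
Proof. by move=> nx; apply: contrapT => Vx; apply: nx; right. Qed.

Lemma nonunitsM a x : V a -> nonunits V x -> nonunits V (a * x).
Proof.
move=> Va [->|nVx]; first by left; rewrite mulr0.
have [->|a0] := eqVneq a 0; first by left; rewrite mul0r.
right; rewrite invfM => Vax; apply: nVx.
by rewrite -[x^-1](mulVKf a0); apply: vringM.
Qed.

(** Of two nonzero elements one divides the other in [V], so the sum is a multiple of the
    divisor. *)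
Lemma nonunitsD x y : nonunits V x -> nonunits V y -> nonunits V (x + y).
Proof.
have aux (u v : F) : v != 0 -> V (u / v) -> nonunits V v -> nonunits V (u + v).
  move=> v0 Vuv Mv.
  suff -> : u + v = (u / v + 1) * v.
    by apply: nonunitsM => //; apply: vringD => //; apply: vring1.
  by rewrite mulrDl mul1r mulfVK.
move=> Mx My.
have [->|x0] := eqVneq x 0; first by rewrite add0r.
have [->|y0] := eqVneq y 0; first by rewrite addr0.
have xy0 : x / y != 0 by rewrite mulf_neq0 ?invr_eq0.
have [Vxy|] := vring_total xy0; first exact: aux.
by rewrite invf_div addrC => Vyx; apply: aux.
Qed.

Lemma nonunits_sum (I : Type) (r : seq I) (p : pred I) (f : I -> F) :
  (forall i, p i -> nonunits V (f i)) -> nonunits V (\sum_(i <- r | p i) f i).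
Proof. by move=> Vf; elim/big_ind: _ => //; [left|apply: nonunitsD]. Qed.

Lemma nonunits_prime : prime_ideal V (nonunits V).
Proof.
split.
- split; [exact: nonunits_sub|by left|exact: nonunitsD|exact: nonunitsM].
- by case=> [/eqP|]; rewrite ?oner_eq0 // invr1; apply; apply: vring1.
- move=> x y _ _ Mxy; apply: contrapT => /not_orP[nx ny].
  have x0 : x != 0 by apply/eqP => x0; apply: nx; left.
  have y0 : y != 0 by apply/eqP => y0; apply: ny; left.
  case: Mxy => [/eqP|]; first by rewrite mulf_eq0 (negPf x0) (negPf y0).
  by rewrite invfM; apply; apply: vringM; apply: unit_vringV.
Qed.

Lemma prime_idealX P x n : prime_ideal V P -> V x -> ~ P x -> ~ P (x ^+ n).
Proof.
move=> [_ P1 Pp] Vx Px; elim: n => [//|n IH]; rewrite exprS.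
by case/(Pp _ _ Vx (vringX n Vx)).
Qed.

(** If [x / y] were not in [V], then [y / x] would be, and [y], a multiple of [x], would lie in [P].
    Once [x / y] is in [V], primeness applied to [x / y * y] puts it in [P]. *)
Lemma prime_ideal_div P x y :
  prime_ideal V P -> P x -> V y -> ~ P y -> P (x / y).
Proof.
move=> [[sP P0 _ PM] P1 Pp] Px Vy Py.
have y0 : y != 0 by apply: contra_not_neq Py => ->.
have [->|x0] := eqVneq x 0; first by rewrite mul0r.
have /vring_total : x / y != 0 by rewrite mulf_neq0 ?invr_eq0.
case=> [Vxy|]; last first.
  by rewrite invf_div => Vyx; case: Py; rewrite -(mulfVK x0 y); apply: PM.
have : P (x / y * y) by rewrite mulfVK.
by case/(Pp _ _ Vxy Vy).
Qed.

Lemma prime_ideal_divX P x y n :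
  prime_ideal V P -> P x -> V y -> ~ P y -> P (x / y ^+ n).
Proof.
move=> PP Px Vy Py; apply: prime_ideal_div => //; first exact: vringX.
exact: prime_idealX.
Qed.

End ValuationRings.

(** * Centers of valuation overrings, and dimension through chain lengths *)

Section ChainLength.
Variable D : idomainType.
Local Notation K := {fraction D}.
Implicit Types (star : set K -> set K) (V E F : set K) (I : set D).

Definition center V : set D := [set d | nonunits V d%:F].

Lemma valuation_overringP V : valuation_overring V <->
  frac_image setT `<=` V /\ valuation_ring V.
Proof. by split=> [[? ? ?]|[? []]]. Qed.

Lemma frac_imageP I d : frac_image I d%:F <-> I d.
Proof.
split=> [[e Ie /eqP]|Id]; last by exists d.
by rewrite tofrac_eq => /eqP <-.
Qed.

Lemma center_prime V : valuation_overring V -> prime_ideal setT (center V).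
Proof.
move=> /valuation_overringP[DV vV]; have [[_ M0 MD MM] M1 Mp] := nonunits_prime vV.
have VD d : V d%:F by apply: DV; exists d.
split; [split|..].
- by [].
- by rewrite /center /= tofrac0.
- by move=> x y; rewrite /center /= tofracD; apply: MD.
- by move=> a x _; rewrite /center /= tofracM; apply: MM.
- by rewrite /center /= tofrac1.
- by move=> x y _ _; rewrite /center /= tofracM; apply: Mp.
Qed.

(** The dimension is the largest [n] with this property, so chain lengths can be compared without
    finding the dimension of any single overring. *)
Definition has_star_chain star (n : nat) : Prop :=
  exists2 V, star_valuation_overring star V & has_prime_chain V n.

Lemma star_dimv_eqP star n : star_dimv_eq star n <->
  has_star_chain star n /\ forall k, has_star_chain star k -> (k <= n)%N.
Proof.
split=> [[le_n [V sV [_ cV]]]|[[V sV cV] le_n]].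
  by split=> [|k [W sW cW]]; [exists V|apply: le_n cW].
have dim_le W : star_valuation_overring star W -> krull_dim_le W n.
  by move=> sW k cW; apply: le_n; exists W.
by split=> //; exists V => //; split=> //; apply: dim_le.
Qed.

End ChainLength.

(** * Finitely generated submodules and products of modules *)

Section FinitelyGenerated.
Variable D : idomainType.
Local Notation K := {fraction D}.
Local Notation span := (@Defs.span D _).
Implicit Types (star : set K -> set K) (V E F G H : set K) (I P Q : set D).

Lemma submodule_sum E n (d : 'I_n -> D) (g : 'I_n -> K) :
  submodule E -> (forall i, E (g i)) -> E (\sum_(i < n) (d i)%:F * g i).
Proof.
by case=> E0 ED EM Eg; elim/big_ind: _ => // i _; apply: EM.
Qed.

Lemma span_submodule n (g : 'I_n -> K) : submodule (span g).
Proof.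
split.
- by exists (fun=> 0); rewrite big1 // => i _; rewrite tofrac0 mul0r.
- move=> x y [d ->] [e ->]; exists (fun i => d i + e i).
  by rewrite -big_split; apply: eq_bigr => i _; rewrite tofracD mulrDl.
- move=> a x [d ->]; exists (fun i => a * d i).
  by rewrite mulr_sumr; apply: eq_bigr => i _; rewrite tofracM mulrA.
Qed.

Lemma span_gen n (g : 'I_n -> K) i : span g (g i).
Proof.
exists (fun j => (j == i)%:R); rewrite (bigD1 i) //= eqxx tofrac1 mul1r.
by rewrite big1 ?addr0 // => j /negPf ->; rewrite tofrac0 mul0r.
Qed.

Lemma span_sub n (g : 'I_n -> K) E :
  submodule E -> (forall i, E (g i)) -> span g `<=` E.
Proof. by move=> sE Eg x [d ->]; apply: submodule_sum. Qed.

Lemma fg_nonzero_submodule F : nonzero_fg_submodule F -> nonzero_submodule F.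
Proof. by case=> F0 [n [g defF]]; split=> //; rewrite defF; apply: span_submodule. Qed.

Lemma fg_singleton x : x != 0 -> exists F,
  [/\ nonzero_fg_submodule F, F x & forall E, submodule E -> E x -> F `<=` E].
Proof.
move=> x0; have Fx : span (fun _ : 'I_1 => x) x by apply: (span_gen _ ord0).
exists (span (fun _ : 'I_1 => x)); split=> [|//|E sE Ex]; last exact: span_sub.
by split; [exists x|exists 1%N; exists (fun=> x)].
Qed.

(** [H] is the sum of the two modules, generated by the concatenated families. *)
Lemma fg_join F G : nonzero_fg_submodule F -> nonzero_fg_submodule G ->
  exists H, [/\ nonzero_fg_submodule H, F `<=` H, G `<=` H
    & forall E, submodule E -> F `<=` E -> G `<=` E -> H `<=` E].
Proof.
move=> [[x Fx x0] [m [f defF]]] [_ [n [g ->]]]; subst F.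
pose h (i : 'I_(m + n)) := match split i with inl j => f j | inr j => g j end.
have sH := span_submodule h.
have Fh : span f `<=` span h.
  apply: span_sub => // i; have -> : f i = h (unsplit (inl i)).
    by rewrite /h unsplitK.
  exact: span_gen.
have Gh : span g `<=` span h.
  apply: span_sub => // i; have -> : g i = h (unsplit (inr i)).
    by rewrite /h unsplitK.
  exact: span_gen.
exists (span h); split=> //.
  by split; [exists x => //; apply: Fh|exists (m + n)%N; exists h].
move=> E sE FE GE; apply: span_sub => // i; rewrite /h.
by case: split => j; [apply/FE/span_gen|apply/GE/span_gen].
Qed.

Lemma prod_mod_sub E F G : F `<=` G -> prod_mod E F `<=` prod_mod E G.
Proof.
move=> FG x [n [e [f [ef ->]]]]; exists n, e, f.
by split=> // i; have [? /FG] := ef i.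
Qed.

Lemma prod_modM E F x y : E x -> F y -> prod_mod E F (x * y).
Proof.
by move=> Ex Fy; exists 1%N, (fun=> x), (fun=> y); rewrite big_ord1.
Qed.

Lemma frac_image_submodule I : ideal setT I -> submodule (frac_image I).
Proof.
case=> _ I0 ID IM; split.
- by rewrite -tofrac0; apply/frac_imageP.
- by move=> _ _ [x Ix <-] [y Iy <-]; rewrite -tofracD; apply/frac_imageP/ID.
- by move=> a _ [x Ix <-]; rewrite -tofracM; apply/frac_imageP/IM.
Qed.

Lemma prod_mod_nonunits F V : valuation_ring V ->
  F `<=` frac_image (center V) -> prod_mod F V `<=` nonunits V.
Proof.
move=> vV FM x [n [e [f [ef ->]]]]; apply: nonunits_sum => // i _.
by have [/FM[d Md <-] Vf] := ef i; rewrite mulrC; apply: nonunitsM.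
Qed.

(** * The operation [star_f], its maximal quasi-ideals, and valuation overrings of [star_tilde] *)

Section Star.
Variable star : set K -> set K.
Hypothesis semi : is_semistar star.

Lemma star_mono E F : nonzero_submodule E -> nonzero_submodule F ->
  E `<=` F -> star E `<=` star F.
Proof. by case: semi => _ _ + _; apply. Qed.

Lemma star_ext E : nonzero_submodule E -> E `<=` star E.
Proof. by case: semi => _ _ _ + /[dup] sE => /(_ _ sE)[]. Qed.

Lemma star_idem E : nonzero_submodule E -> star (star E) = star E.
Proof. by case: semi => _ _ _ + /[dup] sE => /(_ _ sE)[]. Qed.

Lemma star_nonzero_submodule E :
  nonzero_submodule E -> nonzero_submodule (star E).
Proof. by case: semi => + _ _ _; apply. Qed.

Lemma star_sub_star E F : nonzero_submodule E -> nonzero_submodule F ->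
  E `<=` star F -> star E `<=` star F.
Proof.
move=> nE nF EF; rewrite -(star_idem nF); apply: star_mono => //.
exact: star_nonzero_submodule.
Qed.

(** The union defining [star_f] is directed, by [fg_join], so finitely many of its elements lie in
    one [star H]. *)
Lemma star_f_finite E (s : seq K) : nonzero_submodule E ->
  (forall x, x \in s -> star_f star E x) ->
  exists H, [/\ nonzero_fg_submodule H, H `<=` E
    & forall x, x \in s -> star H x].
Proof.
move=> [sE [x Ex x0]]; elim: s => [_|y s IH Es].
  have [F [fF Fx FE]] := fg_singleton x0.
  by exists F; split=> //; apply: FE.
have [|G [fG GE sG]] := IH; first by move=> z zs; apply: Es; rewrite inE zs orbT.
have [|F [fF FE] Fy] := Es y; first by rewrite inE eqxx.
have [H [fH FH GH HE]] := fg_join fF fG; exists H; split=> //; first exact: HE.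
move=> z; rewrite inE => /orP[/eqP ->|/sG].
  by move: Fy; apply: star_mono => //; apply: fg_nonzero_submodule.
by apply: star_mono => //; apply: fg_nonzero_submodule.
Qed.

Lemma star_f_submodule E : nonzero_submodule E ->
  submodule (star_f star E) /\ E `<=` star_f star E.
Proof.
move=> nE; have [sE [e Ee e0]] := nE.
have star_fW F x : nonzero_fg_submodule F -> F `<=` E -> star F x ->
    star_f star E x by move=> fF FE Fx; exists F.
have sub_star F : nonzero_fg_submodule F -> submodule (star F).
  by move=> /fg_nonzero_submodule/star_nonzero_submodule[].
split; [split|].
- have [F [fF _ FE]] := fg_singleton e0.
  by apply: (star_fW F) => //; [apply: FE|case: (sub_star _ fF)].
- move=> x y Ex Ey.
  have [z|F [fF FE Fs]] := @star_f_finite E [:: x; y] nE.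
    by rewrite !inE => /orP[]/eqP->.
  apply: (star_fW F) => //; case: (sub_star _ fF) => _ + _; apply.
    by apply: Fs; rewrite !inE eqxx.
  by apply: Fs; rewrite !inE eqxx orbT.
- move=> a x [F [fF FE] Fx]; apply: (star_fW F) => //.
  by case: (sub_star _ fF) => _ _; apply.
- move=> x Ex; have [->|x0] := eqVneq x 0; last first.
    have [F [fF Fx FE]] := fg_singleton x0.
    apply: (star_fW F) => //; first exact: FE.
    by apply: star_ext => //; apply: fg_nonzero_submodule.
  have [F [fF _ FE]] := fg_singleton e0.
  by apply: (star_fW F) => //; [apply: FE|case: (sub_star _ fF)].
Qed.

(** The generators of [F] lie in a single [star H] with [H] inside [E], so [star F] is inside
    [star H]. This is the idempotence of [star_f] in the form that [exists_QMax] uses. *)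
Lemma star_f_idem E F : nonzero_submodule E -> nonzero_fg_submodule F ->
  F `<=` star_f star E -> star F `<=` star_f star E.
Proof.
move=> nE fF; have nF := fg_nonzero_submodule fF; case: (fF) => _ [n [g defF]] FE.
have [x|H [fH HE Hg]] := star_f_finite (s := [seq g i | i <- enum 'I_n]) nE.
  by case/mapP => i _ ->; apply: FE; rewrite defF; apply: span_gen.
have nH := fg_nonzero_submodule fH.
move=> x Fx; exists H => //; move: Fx; apply: star_sub_star => //.
rewrite defF; apply: span_sub => [|i]; first by case: (star_nonzero_submodule nH).
by apply: Hg; apply: map_f; rewrite mem_enum.
Qed.

Lemma ideal1 I : ideal setT I -> I 1 -> I = setT.
Proof.
case=> _ _ _ IM I1; apply/seteqP; split=> // x _.
by rewrite -[x]mulr1; apply: IM.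
Qed.

Lemma chain_finite (T : eqType) (C : set (set T)) (X0 : set T) (s : seq T) :
  total_on C subset -> C X0 -> (forall x, x \in s -> (\bigcup_(X in C) X) x) ->
  exists2 X, C X & forall x, x \in s -> X x.
Proof.
move=> totC CX0; elim: s => [_|y s IH Us]; first by exists X0.
have [|X CX Xs] := IH; first by move=> z zs; apply: Us; rewrite inE zs orbT.
have [|Y CY Yy] := Us y; first by rewrite inE eqxx.
have [XY|YX] := totC _ _ CX CY.
  by exists Y => // z; rewrite inE => /orP[/eqP ->|/Xs/XY].
by exists X => // z; rewrite inE => /orP[/eqP ->|/Xs]; first exact: YX.
Qed.

(** Containing 1 in the closure has finite character: a witness [F] has finitely many generators,
    and these lie in one member of the chain. Zorn's lemma needs this. *)
Lemma star_f_chain (C : set (set D)) (X0 : set D) :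
  total_on C subset -> C X0 -> (forall X, C X -> ideal setT X) ->
  star_f star (frac_image (\bigcup_(X in C) X)) 1 ->
  exists2 X, C X & star_f star (frac_image X) 1.
Proof.
move=> totC CX0 idC [F [fF FU] F1]; case: (fF) => _ [n [g defF]].
have : forall i, exists d, (\bigcup_(X in C) X) d /\ d%:F = g i.
  move=> i; have /FU[d Ud eq_d] : F (g i) by rewrite defF; apply: span_gen.
  by exists d.
move=> /choice[d Ud].
have [x|X CX Xd] := chain_finite (s := [seq d i | i <- enum 'I_n]) totC CX0.
  by case/mapP => i _ ->; have [] := Ud i.
exists X => //; exists F => //; split=> //; rewrite defF; apply: span_sub.
  by apply: frac_image_submodule; apply: idC.
move=> i; have [_ <-] := Ud i; apply/frac_imageP/Xd.
by apply: map_f; rewrite mem_enum.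
Qed.

(** Zorn's lemma gives [P] maximal among the ideals containing [Q] whose [star_f] omits 1;
    maximality forces [P] to be its own closure in [D], that is, a quasi-ideal for [star_f]. *)
Lemma exists_QMax Q : ideal setT Q -> (exists2 d, Q d & d != 0) ->
  ~ star_f star (frac_image Q) 1 -> exists2 P, QMax (star_f star) P & Q `<=` P.
Proof.
move=> idQ [q Qq q0] Q1.
pose good I := [/\ ideal setT I, Q `<=` I & ~ star_f star (frac_image I) 1].
(* The empty set is adjoined because the union of the empty chain must be admissible; it is not
   maximal, since [Q] is larger. *)
have [|P [gP maxP]] := @Zorn_bigcup _ [set I | I = set0 \/ good I].
  move=> C gC totC; have [[X0 CX0 X00]|C0] := pselect (exists2 X, C X & X <> set0).
    right; pose C' := [set X | C X /\ X <> set0].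
    have gC' X : C' X -> good X by case=> /gC[].
    have -> : \bigcup_(X in C) X = \bigcup_(X in C') X.
      apply/seteqP; split=> x [X CX Xx]; last by exists X => //; case: CX.
      by exists X => //; split=> // X_0; rewrite X_0 in Xx.
    have totC' : total_on C' subset by move=> X Y [CX _] [CY _]; apply: totC.
    have C'X0 : C' X0 by [].
    have idC' X : C' X -> ideal setT X by move/gC' => [].
    split.
    - split=> //.
      + by exists X0 => //; case: (idC' _ C'X0).
      + move=> x y [X CX Xx] [Y CY Yy].
        have [XY|YX] := totC' _ _ CX CY.
          by exists Y => //; case: (idC' _ CY) => _ _ + _; apply=> //; apply: XY.
        by exists X => //; case: (idC' _ CX) => _ _ + _; apply=> //; apply: YX.
      + move=> a x _ [X CX Xx]; exists X => //.
        by case: (idC' _ CX) => _ _ _; apply.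
    - by have [_ QX _] := gC' _ C'X0; move=> x /QX Xx; exists X0.
    - move=> /(star_f_chain totC' C'X0 idC')[X /gC' [_ _ ?] //].
  left; apply/seteqP; split=> // x [X CX Xx]; apply: C0; exists X => // X0.
  by rewrite X0 in Xx.
have {}gP : good P.
  case: gP => // P0; exfalso; apply: (maxP Q); last by right; split.
  by rewrite P0; split=> // /(_ _ Qq).
have {}maxP J : good J -> P `<=` J -> J = P.
  move=> gJ PJ; apply: contrapT => nJP; apply: (maxP J); last by right.
  by split=> // JP; apply: nJP; apply/seteqP.
exists P; last by case: gP.
have [idP QP P1] := gP; have [_ P0 PD PM] := idP.
have nP : nonzero_submodule (frac_image P).
  split; first exact: frac_image_submodule.
  by exists q%:F; rewrite ?tofrac_eq0 //; apply/frac_imageP/QP.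
have [[sf0 sfD sfM] sfP] := star_f_submodule nP.
(* Closing [P] under [star_f] keeps 1 out of the new closure, by [star_f_idem], so maximality gives
   [J = P]. *)
pose J := [set d : D | star_f star (frac_image P) d%:F].
have PJ : P `<=` J by move=> d Pd; apply/sfP/frac_imageP.
have JP : J = P.
  apply: maxP => //; split; last 1 first.
  - case=> F [fF FJ] F1; apply: P1; apply: (star_f_idem nP fF) F1.
    by move=> x /FJ [d Jd <-].
  - split=> //; rewrite /J /=.
    + by move=> x y; rewrite tofracD; apply: sfD.
    + by move=> a x _; rewrite tofracM; apply: sfM.
  - by move=> x /QP/PJ.
split.
  split; first by split=> //; exists q => //; apply: QP.
  by move=> PT; apply: P1; apply: sfP; rewrite -tofrac1; apply/frac_imageP; rewrite PT.
(* A proper quasi-ideal above [P] is again good, since 1 in its closure would make it all of [D]. *)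
move=> I [[idI _ defI] nI] PI; apply: maxP => //; split=> //.
  by move=> x /QP/PI.
by move=> I1; apply/nI/ideal1 => //; rewrite -defI /= tofrac1.
Qed.

Lemma star_tilde_valuation_overringP V :
  star_valuation_overring (star_tilde star) V <->
  valuation_overring V /\ ~ star_f star (frac_image (center V)) 1.
Proof.
split=> -[oV]; have [DV vV] := (valuation_overringP V).1 oV;
  have [idM M1 _] := center_prime oV.
  move=> tildeV; split=> // -[F [fF FM] F1].
  suff /(prod_mod_nonunits vV FM) : prod_mod F V 1.
    by have [_ + _] := nonunits_prime vV.
  apply: tildeV => // P [[[idP _ defP] nP] _].
  (* If [F] were inside the quasi-ideal [P], then 1 would lie in the closure of [P], hence in [P].
     An element of [F] outside [P] is a unit of the localization at [P], so 1 lies in the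
     product. *)
  have [x Fx nPx] : exists2 x, F x & ~ frac_image P x.
    apply: contrapT => /forall2NP noF; apply/nP/ideal1 => //.
    rewrite -defP /= tofrac1; exists F => //; split=> // x Fx.
    by case: (noF x) => // /contrapT.
  have [c Mc def_c] := FM _ Fx; have nPc : ~ P c by rewrite -frac_imageP def_c.
  have c0 : c != 0 by apply: contra_not_neq nPc => ->; case: idP.
  rewrite -[X in prod_mod _ _ X](@mulfV _ c%:F) ?tofrac_eq0 //.
  apply: prod_modM; first by rewrite def_c.
  by exists 1, c; rewrite tofrac1 mul1r.
move=> goodV; split=> // F fF x.
have Vinv d : ~ center V d -> V d%:F^-1 by apply: unit_vringV.
(* Members of [QMax] are nonzero, and [exists_QMax] starts from a nonzero ideal. For a nonzero
   center it gives a [P] containing the center, and then the localization at [P] is inside [V]. *)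
have [[d Md d0]|M0] := pselect (exists2 d, center V d & d != 0).
  have [|P QP MP] := exists_QMax idM _ goodV; first by exists d.
  move=> /(_ P QP); apply: prod_mod_sub => _ [a [b [nPb ->]]].
  apply: (vringM vV); first by apply: DV; exists a.
  by apply: Vinv => /MP.
(* A zero center makes every nonzero element of [D] a unit of [V], hence [V] is all of [K]. *)
have VT y : V y.
  have [a [b [b0 ->]]] := fracP y.
  apply: (vringM vV); first by apply: DV; exists a.
  by apply: Vinv => Mb; apply: M0; exists b.
case: fF => -[f Ff f0] _ _; rewrite -(mulVKf f0 x).
exact: prod_modM.
Qed.

End Star.
End FinitelyGenerated.

(** * The semistar operation star[X] and its valuation overrings *)

Section PolynomialExtension.

(** [polyOver] inspects only the stored coefficients; [E 0] accounts for those beyond the size. *)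
Lemma coef_inP (R : comNzRingType) (E : set R) (p : {poly R}) :
  E 0 -> coef_in E p <-> forall i, E p`_i.
Proof.
move=> E0; split=> [/allP Ep i|Ep].
  have [ip|pi] := ltnP i (size p); last by rewrite nth_default.
  by have := Ep _ (mem_nth 0 ip); rewrite inE.
by apply/allP => _ /(nthP 0)[i _ <-]; rewrite inE.
Qed.

Lemma ideal_sum (R : comNzRingType) (A I : set R) (T : Type) (r : seq T)
    (P : pred T) (f : T -> R) :
  ideal A I -> (forall i, P i -> I (f i)) -> I (\sum_(i <- r | P i) f i).
Proof. by case=> _ I0 ID _ If; elim/big_ind: _. Qed.

(** Gauss's lemma: if [i] and [j] are the least indices of coefficients outside [Q], every other
    term of the coefficient of index [i + j] lies in [Q], so that coefficient does not. *)
Lemma coef_in_prime (R : comNzRingType) (Q : set R) (p q : {poly R}) :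
  prime_ideal setT Q -> coef_in Q (p * q) -> coef_in Q p \/ coef_in Q q.
Proof.
move=> [idQ Q1 Qp]; have [_ Q0 QD QM] := idQ.
rewrite !coef_inP // => Qpq.
apply: contrapT => /not_orP[/existsNP[i0 pi0] /existsNP[j0 qj0]].
have exmin (f : {poly R}) k : ~ Q f`_k ->
    exists2 m, ~ Q f`_m & forall l, (l < m)%N -> Q f`_l.
  move=> fk; have ex : exists m, `[< ~ Q f`_m >] by exists k; apply/asboolP.
  case: (ex_minnP ex) => m /asboolP fm min_m; exists m => // l lm.
  apply: contrapT => fl; have /min_m : `[< ~ Q f`_l >] by apply/asboolP.
  by rewrite leqNgt lm.
have [i pi pmin] := exmin _ _ pi0; have [j qj qmin] := exmin _ _ qj0.
suff : Q (p`_i * q`_j) by case/(Qp _ _ Logic.I Logic.I).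
have /= := Qpq (i + j)%N; have ile : (i < (i + j).+1)%N by rewrite ltnS leq_addr.
rewrite coefM (bigD1 (Ordinal ile)) //= addKn.
set r := (X in _ + X) => Qs; suff Qr : Q r.
  by rewrite -[_ * _](addrK r) -mulN1r; apply: QD => //; apply: QM.
apply: (ideal_sum _ idQ) => k; rewrite -val_eqE /= neq_ltn => /orP[ki|ik].
  by rewrite mulrC; apply: QM => //; apply: pmin.
by apply: QM => //; apply: qmin; rewrite ltn_subLR ?ltn_add2r // -ltnS.
Qed.

Variables (D : idomainType) (star : set {fraction D} -> set {fraction D}).
Hypothesis semi : is_semistar star.
Local Notation K := {fraction D}.
Local Notation D1 := {poly D}.
Local Notation K1 := {fraction {poly D}}.
Local Notation span := (@Defs.span _ _).
Implicit Types (Q : set D1) (E F W : set K1) (s t : {poly D1}).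

Definition contraction Q : set D := [set d | Q d%:P].

Lemma fg_frac_image (R : idomainType) (I : set R) (F : set {fraction R}) :
  nonzero_fg_submodule F -> F `<=` frac_image I ->
  exists n (a : 'I_n -> R), F = span (fun i => (a i)%:F) /\ forall i, I (a i).
Proof.
move=> [_ [n [g ->]]] FI.
have : forall i, exists d, I d /\ d%:F = g i.
  by move=> i; have /FI[d Id <-] := span_gen g i; exists d.
move=> /choice[a Ia]; exists n, a; split; last by move=> i; have [] := Ia i.
by congr Defs.span; apply/funext => i; have [_ ->] := Ia i.
Qed.

Lemma submodule_sub_frac (R : idomainType) (E : set {fraction R}) :
  submodule E -> E 1 -> frac_image setT `<=` E.
Proof. by case=> _ _ EM E1 _ [a _ <-]; rewrite -[a%:F]mulr1; apply: EM. Qed.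

Lemma frac_image_setT_submodule (R : idomainType) :
  nonzero_submodule (frac_image (@setT R)).
Proof.
split; first exact: frac_image_submodule.
by exists 1; rewrite ?oner_neq0 // -tofrac1; apply/frac_imageP.
Qed.

(** A zero contraction contains no nonzero finitely generated module, so its [star_f] is empty. In
    the other alternative, 1 in [star F] would put the whole of [star D] in [star F], and the
    inclusion would not be strict. *)
Lemma Theta1P Q : Theta1 star Q <->
  prime_ideal setT Q /\ ~ star_f star (frac_image (contraction Q)) 1.
Proof.
have nT := frac_image_setT_submodule D.
split=> -[pQ] => [thQ|goodQ]; split=> //.
  case=> F [fF FQ] F1; have nF := fg_nonzero_submodule fF.
  case: thQ => [QD0|[_]].
    case: fF => -[x Fx]; have [d] := FQ _ Fx.
    by rewrite /contraction QD0 => /= -> <-; rewrite tofrac0 eqxx.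
  have DF : frac_image setT `<=` star F.
    by apply: submodule_sub_frac => //; case: (star_nonzero_submodule semi nF).
  by apply=> x /(star_sub_star semi nT nF DF) Fx; exists F.
right; split.
  move=> x [F [fF FQ]]; apply: star_mono => //; first exact: fg_nonzero_submodule.
  by move=> y /FQ[d _ <-]; exists d.
move=> /(_ 1) h; apply: goodQ; apply: h; apply: (star_ext semi nT).
by exists 1; rewrite ?tofrac1.
Qed.

(** This keeps 0 out of [frakS1], so its elements can serve as denominators. *)
Lemma prime0_Theta1 : Theta1 star [set 0].
Proof.
split.
  split=> [|/eqP|x y _ _ /eqP]; last 2 first.
  - by rewrite oner_eq0.
  - by rewrite mulf_eq0 => /orP[]/eqP ->; [left|right].
  by split=> // [x y -> ->|a x _ ->]; rewrite ?addr0 ?mulr0.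
left; apply/seteqP; split=> d /=; first by move/eqP; rewrite polyC_eq0 => /eqP.
by move=> ->; rewrite polyC0.
Qed.

Lemma frakS1P s :
  frakS1 star s <-> forall Q, Theta1 star Q -> exists i, ~ Q s`_i.
Proof.
have Q0 Q : Theta1 star Q -> Q 0 by case=> [[[]]].
split=> [Ss Q tQ|Ss [Q tQ]].
  apply/existsNP => Qs; apply: Ss; exists Q => //.
  by apply/coef_inP => //; apply: Q0.
by move=> /coef_inP; move=> /(_ (Q0 _ tQ)) Qs; have [i] := Ss _ tQ; apply.
Qed.

Lemma frakS1_1 : frakS1 star 1.
Proof.
apply/frakS1P => Q [[_ Q1 _] _]; exists 0%N.
by rewrite -polyC1 coefC.
Qed.

Lemma frakS1M s t : frakS1 star s -> frakS1 star t -> frakS1 star (s * t).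
Proof.
move=> Ss St [Q tQ]; case: (tQ) => pQ _ /(coef_in_prime pQ)[Qs|Qt].
  by apply: Ss; exists Q.
by apply: St; exists Q.
Qed.

Lemma frakS1_prod (n : nat) (t : nat -> {poly D1}) :
  (forall i, frakS1 star (t i)) -> frakS1 star (\prod_(i < n) t i).
Proof.
by move=> St; elim/big_ind: _ => //; [apply: frakS1_1|apply: frakS1M].
Qed.

Lemma frakS1_neq0 s : frakS1 star s -> s != 0.
Proof.
move=> /frakS1P/(_ _ prime0_Theta1)[i].
by apply: contra_not_neq => ->; rewrite coef0.
Qed.

(** Clearing the denominator in [x = e / s] and comparing coefficients; from here on the field
    K_1(Y) is no longer needed. *)
Lemma star_polyP E x : E 0 -> star_poly star E x <->
  exists2 s, frakS1 star s & forall i, E (x * (s`_i)%:F).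
Proof.
move=> E0; have map0 s : s != 0 -> map_poly (@FracField.tofrac D1) s != 0.
  move=> s0; rewrite map_poly_eq0_id0 //.
  by rewrite tofrac_eq0 lead_coef_eq0.
split=> [[e [s [/coef_inP Ee Ss eq_x]]]|[s Ss Es]].
  exists s => // i.
  suff <- : e`_i = x * (s`_i)%:F by apply: Ee.
  have : (x%:P * map_poly (@FracField.tofrac D1) s)%:F = e%:F.
    by rewrite tofracM eq_x mulfVK // tofrac_eq0; apply/map0/frakS1_neq0.
  by move/eqP; rewrite tofrac_eq => /eqP <-; rewrite coefCM coef_map.
exists (x%:P * map_poly (@FracField.tofrac D1) s), s; split=> //.
  by apply/coef_inP => // i; rewrite coefCM coef_map; apply: Es.
by rewrite tofracM mulfK // tofrac_eq0; apply/map0/frakS1_neq0.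
Qed.

Lemma submoduleMr E x (d : D1) : submodule E -> E x -> E (x * d%:F).
Proof. by case=> _ _ EM Ex; rewrite mulrC; apply: EM. Qed.

Lemma submodule_coefM E x s t : submodule E ->
  (forall i j, E (x * (s`_i)%:F * (t`_j)%:F)) ->
  forall k, E (x * ((s * t)`_k)%:F).
Proof.
move=> [E0 ED EM] Est k; rewrite coefM rmorph_sum mulr_sumr.
by elim/big_ind: _ => // i _; rewrite rmorphM mulrA; apply: Est.
Qed.

Lemma star_poly_mono E F : submodule E -> submodule F ->
  E `<=` F -> star_poly star E `<=` star_poly star F.
Proof.
move=> [E0 _ _] [F0 _ _] EF x /(star_polyP _ E0)[s Ss Es].
by apply/star_polyP => //; exists s => // i; apply: EF.
Qed.

Lemma star_poly_ext E : submodule E -> E `<=` star_poly star E.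
Proof.
move=> sE x Ex; apply/star_polyP; first by case: sE.
by exists 1 => [|i]; [exact: frakS1_1|apply: submoduleMr].
Qed.

Lemma star_poly_submodule E : submodule E -> submodule (star_poly star E).
Proof.
move=> sE; have [E0 ED EM] := sE; split.
- exact: star_poly_ext.
- move=> x y /(star_polyP _ E0)[s Ss Es] /(star_polyP _ E0)[t St Et].
  apply/star_polyP => //; exists (s * t); first exact: frakS1M.
  apply: submodule_coefM => // i j; rewrite !mulrDl; apply: ED.
    exact: submoduleMr.
  by rewrite mulrAC; apply: submoduleMr.
- move=> a x /(star_polyP _ E0)[s Ss Es].
  by apply/star_polyP => //; exists s => // i; rewrite -mulrA; apply: EM.
Qed.

Lemma star_poly_idem E :
  submodule E -> star_poly star (star_poly star E) = star_poly star E.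
Proof.
move=> sE; have sE' := star_poly_submodule sE; have [E0 _ _] := sE.
apply/seteqP; split; last exact: star_poly_ext.
move=> x /star_polyP[|s Ss Es]; first by case: sE'.
have : forall i, exists t, frakS1 star t /\ forall j, E (x * (s`_i)%:F * (t`_j)%:F).
  by move=> i; have /(star_polyP _ E0)[t St Et] := Es i; exists t.
move=> /choice[t Et]; apply/star_polyP => //.
(* [t i] is a denominator for [x * s_i]; as [s] has finitely many coefficients, a finite product
   serves them all. *)
exists (s * \prod_(i < size s) t i).
  by apply: frakS1M => //; apply: frakS1_prod => i; have [] := Et i.
apply: submodule_coefM => // i j.
have [i_s|s_i] := ltnP i (size s); last first.
  by rewrite nth_default // tofrac0 mulr0 mul0r.
rewrite (bigD1 (Ordinal i_s)) //= mulrC.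
have [_ Eti] := Et i; rewrite mulrC.
by apply: submodule_coefM => // k l; apply: submoduleMr.
Qed.

Lemma scale_setE (x y : K1) E : x != 0 -> scale_set x E y <-> E (x^-1 * y).
Proof.
by move=> x0; split=> [[e Ee <-]|Ey]; [rewrite mulKf|exists (x^-1 * y); rewrite ?mulVKf].
Qed.

Lemma star_poly_semistar : is_semistar (star_poly star).
Proof.
split.
- move=> E [sE [x Ex x0]]; split; first exact: star_poly_submodule.
  by exists x => //; apply: star_poly_ext.
- move=> x E x0 [[E0 ED EM] _].
  have xE0 : scale_set x E 0 by apply/scale_setE => //; rewrite mulr0.
  apply/seteqP; split=> y.
    move=> /(star_polyP _ xE0)[s Ss Es]; apply/scale_setE => //.
    apply/star_polyP => //; exists s => // i; rewrite -mulrA.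
    exact/scale_setE.
  move=> /(scale_setE _ _ x0)/(star_polyP _ E0)[s Ss Es].
  apply/star_polyP => //; exists s => // i; apply/scale_setE => //.
  by rewrite mulrA.
- by move=> E F [sE _] [sF _]; apply: star_poly_mono.
- move=> E [sE _]; split; first exact: star_poly_ext.
  exact: star_poly_idem.
Qed.

(** If 1 is in the star[X]-closure of some [F] inside [Q], some [s] in [frakS1] has all its
    coefficients in [Q], so [Q] is not in [Theta1]. The converse makes such an [s] out of generators
    in the contraction. *)
Lemma star_f_star_poly Q : prime_ideal setT Q ->
  star_f (star_poly star) (frac_image Q) 1 <->
  star_f star (frac_image (contraction Q)) 1.
Proof.
move=> pQ; split=> [[F [fF FQ]]|[F [fF FQ] F1]].
  have [[F0 _ _] _] := fg_nonzero_submodule fF.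
  move=> /(star_polyP _ F0)[s Ss Fs]; apply: contrapT => goodQ.
  have [i] := (frakS1P s).1 Ss Q ((Theta1P Q).2 (conj pQ goodQ)).
  by apply; apply/frac_imageP/FQ; rewrite -[_%:F]mul1r.
have [n [a [defF Qa]]] := fg_frac_image fF FQ.
pose b i : K1 := ((a i)%:P)%:F.
have [i0 ai0] : exists i, a i != 0.
  apply: contrapT => /forallNP a0; case: fF => -[x Fx /eqP[]].
  move: Fx; rewrite defF => -[d ->]; rewrite big1 // => i _.
  by have /negP := a0 i; rewrite negbK => /eqP ->; rewrite tofrac0 mulr0.
have fb : nonzero_fg_submodule (span b).
  split; last by exists n; exists b.
  by exists (b i0); [apply: span_gen|rewrite tofrac_eq0 polyC_eq0].
exists (span b).
  split=> //; apply: span_sub => [|i].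
    by apply: frac_image_submodule; case: pQ.
  by apply/frac_imageP/Qa.
have [sb _] := fg_nonzero_submodule fb; have [b0 _ _] := sb.
(* The polynomial with coefficients a_i avoids every Q in Theta1, since the
   ideal (a_i) has star-closure containing 1. *)
pose c k : D1 := if insub k is Some i then (a i)%:P else 0.
have cE (i : 'I_n) : c i = (a i)%:P by rewrite /c valK.
apply/star_polyP => //; exists (\poly_(k < n) c k).
  apply/frakS1P => P /Theta1P[pP goodP]; apply/existsNP => cP; apply: goodP.
  exists F => //; split=> //; rewrite defF; apply: span_sub => [|i].
    apply: frac_image_submodule; case: pP => -[_ P0 PD PM] _ _.
    split=> //=.
      by move=> x y; rewrite /contraction /= polyCD; apply: PD.
    by move=> x y _; rewrite /contraction /= polyCM; apply: PM.
  apply/frac_imageP; have /= := cP i; rewrite coef_poly ltn_ord cE.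
  exact.
move=> k; rewrite mul1r coef_poly; case: ltnP => [kn|_]; last by rewrite tofrac0.
by have /= -> := cE (Ordinal kn); apply: span_gen.
Qed.

Lemma star_poly_valuation_overringP W :
  star_valuation_overring (star_poly star) W <->
  valuation_overring W /\
  ~ star_f star (frac_image (contraction (center W))) 1.
Proof.
split=> -[oW starW]; have [DW vW] := (valuation_overringP W).1 oW;
  have pW := center_prime oW; split=> //.
  move=> /(star_f_star_poly pW)[F [fF FW] F1].
  have /(prod_mod_nonunits vW FW) := starW _ fF _ F1.
  by have [_ + _] := nonunits_prime vW.
move=> F fF x; have [[F0 _ _] _] := fg_nonzero_submodule fF.
move=> /(star_polyP _ F0)[s Ss Fs].
(* A coefficient of [s] outside the center is a unit of [W], so dividing [x * s_i] by it stays in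
   the product. *)
have [i si] := (frakS1P s).1 Ss _ ((Theta1P _).2 (conj pW starW)).
have si0 : (s`_i)%:F != 0 by apply/eqP => e; apply: si; left.
rewrite -(mulfK si0 x); apply: prod_modM => //.
exact: unit_vringV.
Qed.

(** One condition concerns the center of [W] on [D[X]], the other its contraction to [D];
    [star_f_star_poly] makes them agree. *)
Lemma star_tilde_star_poly W :
  star_valuation_overring (star_tilde (star_poly star)) W <->
  star_valuation_overring (star_poly star) W.
Proof.
rewrite star_poly_valuation_overringP.
rewrite (star_tilde_valuation_overringP star_poly_semistar).
split=> -[oW goodW]; split=> //.
  by move=> /(star_f_star_poly (center_prime oW)).
by move=> /(star_f_star_poly (center_prime oW)).
Qed.

End PolynomialExtension.

(** * The embedding of K in K(X) and traces of valuation overrings *)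

Section BaseField.
Variable D : idomainType.
Local Notation K := {fraction D}.
Local Notation D1 := {poly D}.
Local Notation K1 := {fraction {poly D}}.

Lemma eq_divF (R : idomainType) (a b c d : R) : b != 0 -> d != 0 ->
  a%:F / b%:F = c%:F / d%:F <-> a * d = c * b.
Proof.
move=> b0 d0; split=> [/eqP|e].
  by rewrite eqr_div ?tofrac_eq0 // -!tofracM tofrac_eq => /eqP.
by apply/eqP; rewrite eqr_div ?tofrac_eq0 // -!tofracM e.
Qed.

(** The inclusion of K in K(X), defined through a chosen representative; [constF_div] removes the
    choice. *)
Definition constF (x : K) : K1 :=
  ((\n_(repr x))%:P)%:F / ((\d_(repr x))%:P)%:F.

Lemma constF_div a b : b != 0 -> constF (a%:F / b%:F) = (a%:P)%:F / (b%:P)%:F.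
Proof.
move=> b0; rewrite /constF; set y := repr _; have y0 := denom_ratioP y.
apply/eq_divF; rewrite ?polyC_eq0 // -!polyCM; congr _%:P.
by apply/(eq_divF _ _ y0 b0); rewrite -frac_repr.
Qed.

Lemma constF_tofrac a : constF a%:F = (a%:P)%:F.
Proof.
by rewrite -[a%:F]divr1 -tofrac1 constF_div ?oner_neq0 // polyC1 tofrac1 divr1.
Qed.

Lemma constF_zmod_morphism : zmod_morphism constF.
Proof.
move=> x y; have [a [b [b0 ->]]] := fracP x; have [c [d [d0 ->]]] := fracP y.
have e (R : idomainType) (a' b' c' d' : R) : b' != 0 -> d' != 0 ->
    a'%:F / b'%:F - c'%:F / d'%:F = (a' * d' - c' * b')%:F / (b' * d')%:F.
  by move=> b'0 d'0; rewrite -mulNr addf_div ?tofrac_eq0 // mulNr -!tofracM -tofracB.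
by rewrite e // !constF_div ?mulf_neq0 // e ?polyC_eq0 // polyCB !polyCM.
Qed.

Lemma constF_monoid_morphism : monoid_morphism constF.
Proof.
split=> [|x y]; first by rewrite -tofrac1 constF_tofrac polyC1 tofrac1.
have [a [b [b0 ->]]] := fracP x; have [c [d [d0 ->]]] := fracP y.
rewrite mulf_div -!tofracM !constF_div ?mulf_neq0 //.
by rewrite mulf_div -!tofracM -!polyCM.
Qed.

HB.instance Definition _ :=
  GRing.isZmodMorphism.Build K K1 constF constF_zmod_morphism.
HB.instance Definition _ :=
  GRing.isMonoidMorphism.Build K K1 constF constF_monoid_morphism.

Lemma constF_preim_valuation (W : set K1) :
  valuation_overring W -> valuation_overring (constF @^-1` W).
Proof.
move=> /valuation_overringP[DW vW]; apply/valuation_overringP; split.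
  by move=> _ [a _ <-] /=; rewrite constF_tofrac; apply: DW; exists a%:P.
split; last first.
  by move=> x x0; rewrite /= fmorphV; apply: vring_total => //; rewrite fmorph_eq0.
split.
- by rewrite inE /= rmorph1; apply: vring1.
- by move=> x y; rewrite !inE /= rmorphB; apply: vringB.
- by move=> x y; rewrite !inE /= rmorphM; apply: vringM.
Qed.

Lemma center_constF_preim (W : set K1) :
  center (constF @^-1` W) = contraction (center W).
Proof.
apply/seteqP; split=> d; rewrite /center /contraction /nonunits /=;
  rewrite fmorphV /= constF_tofrac.
  by case=> [/eqP|]; [rewrite tofrac_eq0 => /eqP ->; left; rewrite polyC0 tofrac0|right].
by case=> [/eqP|]; [rewrite tofrac_eq0 polyC_eq0 => /eqP ->; left; rewrite tofrac0|right].
Qed.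

(** * Algebraic dependence over K of two elements of K(X) *)

Lemma row_kernel (F : fieldType) m n (M : 'M[F]_(m, n)) : (n < m)%N ->
  exists2 v : 'rV_m, v != 0 & v *m M = 0.
Proof.
move=> nm; have : ~~ row_free M.
  by rewrite /row_free neq_ltn (leq_ltn_trans (rank_leq_col M) nm).
rewrite -kermx_eq0 => /rowV0Pn[v vM v0]; exists v => //.
exact/sub_kermxP.
Qed.

(** The matrix of coefficients has more rows than columns, so a nonzero row vector annihilates
    it. *)
Lemma poly_dependent (I : finType) (u : I -> D1) (m : nat) :
  (forall i, (size (u i) <= m)%N) -> (m < #|I|)%N ->
  exists2 c : I -> K, exists i, c i != 0 & \sum_i constF (c i) * (u i)%:F = 0.
Proof.
move=> um mI.
pose M := \matrix_(i < #|I|, k < m) ((u (enum_val i))`_k)%:F : 'M[K]_(_, _).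
have [v v0 vM] := row_kernel M mI.
exists (fun i => v 0 (enum_rank i)).
  have [j vj] := rV0Pn _ v0; by exists (enum_val j); rewrite enum_valK.
have uE i : (u i)%:F = \sum_(k < m) constF ((u i)`_k)%:F * ('X%:F ^+ k : K1).
  rewrite -{1}(coefK (u i)) poly_def (big_ord_widen _ (fun k => (u i)`_k *: 'X^k) (um i)).
  rewrite big_mkcond rmorph_sum /=; apply: eq_bigr => k _.
  case: ltnP => [_|uk]; last by rewrite nth_default // rmorph0 rmorph0 mul0r.
  by rewrite -mul_polyC tofracM tofracXn constF_tofrac.
under eq_bigr => i _ do rewrite uE mulr_sumr.
rewrite exchange_big big1 //= => k _.
under eq_bigr => i _ do rewrite mulrA -rmorphM /=.
rewrite -mulr_suml -rmorph_sum /=.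
suff -> : \sum_i v 0 (enum_rank i) * ((u i)`_k)%:F = 0 by rewrite rmorph0 mul0r.
have /matrixP/(_ 0 k) := vM; rewrite !mxE => {2}<-.
rewrite (reindex (@enum_val I I)) /=; last by apply: onW_bij; apply: enum_val_bij.
by apply: eq_bigr => i _; rewrite enum_valK mxE.
Qed.

Lemma algebraic_dependence (a b : K1) : exists N (c : 'I_N * 'I_N -> K),
  (exists i, c i != 0) /\ \sum_i constF (c i) * (a ^+ i.1 * b ^+ i.2) = 0.
Proof.
have [f1 [h1 [h10 ->]]] := fracP a; have [g1 [h2 [h20 ->]]] := fracP b.
pose f := f1 * h2; pose g := g1 * h1; pose h := h1 * h2.
have h0 : h%:F != 0 :> K1 by rewrite tofrac_eq0 mulf_neq0.
have -> : f1%:F / h1%:F = f%:F / h%:F :> K1.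
  by apply/eq_divF; rewrite ?mulf_neq0 // /f /h; ring.
have -> : g1%:F / h2%:F = g%:F / h%:F :> K1.
  by apply/eq_divF; rewrite ?mulf_neq0 // /g /h; ring.
clearbody f g h.
(* [d] bounds all three sizes. The value of [N] makes the number [(N + 1)^2] of monomials exceed the
   [2 d N + 1] coefficients of a polynomial of degree at most [2 d N]. *)
pose d := (size f + size g + size h)%N; pose N := (2 * d)%N.+1.
have sX (p : D1) n : (size p <= d)%N -> (size (p ^+ n) <= (d * n).+1)%N.
  move=> pd; apply: leq_trans (size_poly_exp_leq _ _) _.
  by rewrite ltnS leq_mul2r; apply/orP; right; lia.
have sM (p q : D1) k l : (size p <= k.+1)%N -> (size q <= l.+1)%N ->
    (size (p * q)%R <= (k + l).+1)%N.
  move=> pk ql; apply: leq_trans (size_polyMleq _ _) _.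
  lia.
(* This is the monomial in [f / h] and [g / h] times [h ^+ (2 * N)]; both exponents are at most [N],
   so the subtraction is exact. *)
pose u (i : 'I_N.+1 * 'I_N.+1) : D1 := f ^+ i.1 * g ^+ i.2 * h ^+ (2 * N - i.1 - i.2).
have [i||c c0 sumc] := @poly_dependent _ u (d * (2 * N)).+1.
- have := sM _ _ _ _ (sM _ _ _ _ (sX f i.1 _) (sX g i.2 _)) (sX h (2 * N - i.1 - i.2)%N _).
  rewrite -!mulnDr => /(_ _ _ _)/leq_trans; apply; rewrite /d; try lia.
  by rewrite ltnS leq_mul2l; apply/orP; right; case: i => -[i ?] [j ?] /=; lia.
- by rewrite card_prod !card_ord /N; nia.
exists N.+1, c; split=> //; apply: (@mulIf _ (h%:F ^+ (2 * N))).
  by rewrite expf_neq0.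
rewrite mul0r mulr_suml -[RHS]sumc; apply: eq_bigr => -[[i iN] [j jN]] _ /=.
rewrite -mulrA; congr (_ * _); rewrite /u /= !tofracM !tofracXn.
pose r := (2 * N - i - j)%N; rewrite -/r.
have -> : h%:F ^+ (2 * N) = h%:F ^+ r * h%:F ^+ i * h%:F ^+ j :> K1.
  by rewrite -!exprD; congr (_ ^+ _); rewrite /r; lia.
rewrite !expr_div_n.
have cancel (F : fieldType) (x y z t v : F) : z != 0 -> t != 0 ->
    x / z * (y / t) * (v * z * t) = x * y * v.
  by move=> z0 t0; field; rewrite z0 t0.
by rewrite cancel ?expf_neq0.
Qed.

End BaseField.

Lemma preim_prime (K L : fieldType) (f : {rmorphism K -> L}) (W P : set L) :
  prime_ideal W P -> prime_ideal (f @^-1` W) (f @^-1` P).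
Proof.
move=> [[PW P0 PD PM] P1 Pp]; split; [split|..] => /=.
- by move=> x; apply: PW.
- by rewrite rmorph0.
- by move=> x y; rewrite rmorphD; apply: PD.
- by move=> x y; rewrite rmorphM; apply: PM.
- by rewrite rmorph1.
- by move=> x y; rewrite rmorphM; apply: Pp.
Qed.

(** * Comparing values of sums and of monomials *)

Section ValueCollision.
Variables (F : fieldType) (V : set F).
Hypothesis valV : valuation_ring V.

(** Divisibility in [V] is a total preorder on nonzero elements; zero entries count as having
    infinite value. *)
Lemma exists_min_value (I : eqType) (s : seq I) (x : I -> F) :
  (exists2 i, i \in s & x i != 0) ->
  exists i, [/\ i \in s, x i != 0 & forall k, k \in s -> V (x k / x i)].
Proof.
elim: s => [[i]//|j s IH] ex.
have Vxx i : V (x i / x i).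
  have [->|xi] := eqVneq (x i) 0; first by rewrite mul0r; apply: vring0.
  by rewrite divff //; apply: vring1.
have [[i si xi]|none] := pselect (exists2 i, i \in s & x i != 0); last first.
  have x0 k : k \in s -> x k = 0.
    by move=> ks; apply: contrapT => /eqP xk; apply: none; exists k.
  exists j; split; first by rewrite inE eqxx.
    by case: ex => k; rewrite inE => /orP[/eqP ->|/x0 -> /eqP].
  move=> k; rewrite inE => /orP[/eqP ->//|/x0 ->].
  by rewrite mul0r; apply: vring0.
have [|k [ks xk minx]] := IH; first by exists i.
have [xj|xj] := eqVneq (x j) 0.
  exists k; split=> //; first by rewrite inE ks orbT.
  move=> l; rewrite inE => /orP[/eqP ->|/minx//].
  by rewrite xj mul0r; apply: vring0.
have jk0 : x j / x k != 0 by rewrite mulf_neq0 ?invr_eq0.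
have [Vjk|Vkj] := vring_total valV jk0.
  exists k; split=> //; first by rewrite inE ks orbT.
  by move=> l; rewrite inE => /orP[/eqP ->|/minx].
exists j; split=> //; first by rewrite inE eqxx.
move=> l; rewrite inE => /orP[/eqP ->//|/minx Vlk].
have -> : x l / x j = x l / x k * (x j / x k)^-1 by field; rewrite xj xk.
exact: vringM.
Qed.

(** If the least value were attained only once, dividing the sum by that term would express 1 as a
    sum of nonunits. *)
Lemma sum0_value_collision (I : finType) (x : I -> F) :
  (exists i, x i != 0) -> \sum_i x i = 0 ->
  exists i k, [/\ i != k, x i != 0, x k != 0, V (x i / x k) & V (x k / x i)].
Proof.
move=> [i xi] sum0.
have [|k [_ xk minx]] := @exists_min_value I (index_enum I) x.
  by exists i => //; rewrite mem_index_enum.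
apply: contrapT => noc; have [_ + _] := nonunits_prime valV; apply.
have /eqP : (\sum_j x j) / x k = 0 by rewrite sum0 mul0r.
rewrite mulr_suml (bigD1 k) //= divff // addr_eq0 => /eqP ->.
rewrite -mulN1r; apply: nonunitsM => //.
  by apply: vringN => //; apply: vring1.
apply: nonunits_sum => // j jk.
have [xj|xj] := eqVneq (x j) 0; first by left; rewrite xj mul0r.
right; rewrite invf_div => Vkj; apply: noc; exists j, k; split=> //.
by apply: minx; rewrite mem_index_enum.
Qed.

(** As [u] is a unit, [z^-1] has the value of the quotient of the two monomials. If the exponents of
    [a] differ, [a] decides, since [b] is outside [P'] and its powers can be divided out; if they
    agree, a positive power of [b] remains. *)
Lemma monomial_separates (P P' Q Q' : set F) (a b : F) (k l k' l' : nat) (z : F) :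
    prime_ideal V P -> prime_ideal V P' -> prime_ideal V Q -> prime_ideal V Q' ->
    P `<=` P' -> P' `<=` Q -> P' a -> ~ P a -> Q' b -> ~ Q b ->
    let u := z * (a ^+ k * b ^+ l) / (a ^+ k' * b ^+ l') in
    V u -> V u^-1 -> z != 0 -> (k' < k)%N || (k == k') && (l' < l)%N ->
  (P' z^-1 /\ ~ P z^-1) \/ (Q' z^-1 /\ ~ Q z^-1).
Proof.
move=> pP pP' pQ pQ' PP' P'Q P'a Pa Q'b Qb u Vu Vu' z0.
have [[_ P0 _ PM] _ Pp] := pP; have [[P'V _ _ P'M] _ _] := pP'.
have [[_ Q0 _ QM] _ _] := pQ; have [[Q'V _ _ Q'M] _ _] := pQ'.
have [Va Vb] := (P'V _ P'a, Q'V _ Q'b).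
have a0 : a != 0 by apply: contra_not_neq Pa => ->.
have b0 : b != 0 by apply: contra_not_neq Qb => ->.
have VX := @vringX _ _ valV.
case/orP => [lt_k|/andP[/eqP eq_k lt_l]].
  (* The predecessor sets one factor [a] aside, so that [a / b ^+ l'] can be placed in [P']. *)
  left; pose m := (k - k').-1.
  have ak : a ^+ k = a ^+ m.+1 * a ^+ k'.
    by rewrite -exprD; congr (_ ^+ _); rewrite /m; lia.
  have eu : u = z * a ^+ m.+1 * (b ^+ l / b ^+ l').
    rewrite /u ak invfM; set A := a ^+ k'; have A0 : A != 0 by rewrite expf_neq0.
    by rewrite -[RHS](mulfK A0); ring.
  have bl0 n : b ^+ n != 0 by rewrite expf_neq0.
  split.
    have -> : z^-1 = u^-1 * (a ^+ m * b ^+ l * (a / b ^+ l')).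
      rewrite eu exprSr; move: (a ^+ m) (expf_neq0 m a0) (bl0 l) (bl0 l').
      move: (b ^+ l) (b ^+ l') => B B' A A0 B0 B'0.
      by field; rewrite z0 a0 A0 B0 B'0.
    apply: (P'M) => //; apply: (P'M); first by apply: (vringM valV) => //; apply: VX.
    by apply: (prime_ideal_divX valV) => //; move/P'Q.
  move=> Pz; have : P (a ^+ m.+1 * b ^+ l).
    have -> : a ^+ m.+1 * b ^+ l = b ^+ l' * u * z^-1.
      rewrite eu; move: (a ^+ m.+1) (bl0 l'); move: (b ^+ l') (b ^+ l).
      by move=> B' B A B'0; field; rewrite z0 B'0.
    by apply: PM => //; apply: (vringM valV) => //; apply: VX.
  case/(Pp _ _ (VX _ _ Va) (VX _ _ Vb)); apply: (prime_idealX valV) => //.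
  by move/PP'/P'Q.
right; pose m := (l - l').-1.
have eu : u = z * b ^+ m.+1.
  have -> : b ^+ m.+1 = b ^+ l / b ^+ l'.
    rewrite -[LHS](mulfK (expf_neq0 l' b0)) -exprD; congr (_ ^+ _ / _).
    by rewrite /m; lia.
  rewrite /u eq_k; move: (a ^+ k') (expf_neq0 k' a0) (b ^+ l).
  move: (b ^+ l') (expf_neq0 l' b0) => B' B'0 A A0 B.
  by field; rewrite A0 B'0.
have bm0 : b ^+ m.+1 != 0 by rewrite expf_neq0.
split.
  have -> : z^-1 = u^-1 * (b ^+ m * b).
    rewrite eu -exprSr; move: (b ^+ m.+1) bm0 => B B0.
    by field; rewrite z0 B0.
  by apply: (Q'M) => //; apply: (Q'M) => //; apply: VX.
move=> Qz; suff : Q (b ^+ m.+1) by apply: (prime_idealX valV).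
have -> : b ^+ m.+1 = u * z^-1 by rewrite eu mulrAC divff // mul1r.
exact: QM.
Qed.

End ValueCollision.

(** * Tracing a chain of primes on the smaller field *)

Section DimensionInequality.
Variables (K L : fieldType) (iota : {rmorphism K -> L}).
Hypothesis dependent : forall a b : L, exists N (c : 'I_N * 'I_N -> K),
  (exists i, c i != 0) /\ \sum_i iota (c i) * (a ^+ i.1 * b ^+ i.2) = 0.
Variable W : set L.
Hypothesis valW : valuation_ring W.

Definition separated (P P' : set L) : Prop :=
  exists z : K, P' (iota z) /\ ~ P (iota z).

(* a in P' \ P and b in Q' \ Q are algebraically dependent over K, so two
   monomials c a^k b^l in a dependence relation have the same value, and b is
   infinitely smaller than a in value. *)
Lemma prime_pairs_separated (P P' Q Q' : set L) :
    prime_ideal W P -> prime_ideal W P' -> prime_ideal W Q -> prime_ideal W Q' ->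
    P `<` P' -> P' `<=` Q -> Q `<` Q' ->
  separated P P' \/ separated Q Q'.
Proof.
move=> pP pP' pQ pQ' [PP' /existsNP[a /not_implyP[P'a Pa]]] P'Q.
move=> [_ /existsNP[b /not_implyP[Q'b Qb]]].
have [[_ P0 _ _] _ _] := pP; have [[_ Q0 _ _] _ _] := pQ.
have a0 : a != 0 by apply: contra_not_neq Pa => ->.
have b0 : b != 0 by apply: contra_not_neq Qb => ->.
have [N [c [[i0 ci0] sum0]]] := dependent a b.
have x_neq0 i : (iota (c i) * (a ^+ i.1 * b ^+ i.2) != 0) = (c i != 0).
  by rewrite mulf_eq0 fmorph_eq0 (negPf (mulf_neq0 _ _)) ?orbF //; apply: expf_neq0.
have [|i [j []]] := sum0_value_collision valW _ sum0.
  by exists i0; rewrite x_neq0.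
rewrite !x_neq0 => ij ci cj.
have eu (r t : 'I_N * 'I_N) :
    iota (c r) * (a ^+ r.1 * b ^+ r.2) / (iota (c t) * (a ^+ t.1 * b ^+ t.2)) =
    iota (c r / c t) * (a ^+ r.1 * b ^+ r.2) / (a ^+ t.1 * b ^+ t.2).
  by rewrite rmorphM fmorphV /= invfM mulrACA mulrA.
have sep (r t : 'I_N * 'I_N) : c r != 0 -> c t != 0 ->
    W (iota (c r) * (a ^+ r.1 * b ^+ r.2) / (iota (c t) * (a ^+ t.1 * b ^+ t.2))) ->
    W (iota (c t) * (a ^+ t.1 * b ^+ t.2) / (iota (c r) * (a ^+ r.1 * b ^+ r.2))) ->
    (t.1 < r.1)%N || (r.1 == t.1 :> nat) && (t.2 < r.2)%N ->
    separated P P' \/ separated Q Q'.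
  move=> cr ct; rewrite -[X in _ -> W X -> _]invf_div eu => Wu Wu' lt_tr.
  have crt : iota (c r / c t) != 0 by rewrite fmorph_eq0 mulf_neq0 ?invr_eq0.
  have := monomial_separates valW pP pP' pQ pQ' PP' P'Q P'a Pa Q'b Qb Wu Wu' crt lt_tr.
  by rewrite -fmorphV => -[]; [left|right]; exists (c r / c t)^-1.
move=> Wij Wji.
have [lt_ji|lt_ij] : ((j.1 < i.1) || (i.1 == j.1 :> nat) && (j.2 < i.2))%N \/
    ((i.1 < j.1) || (j.1 == i.1 :> nat) && (i.2 < j.2))%N.
  apply/orP; move: ij; rewrite -pair_eqE /= -!val_eqE /=; lia.
- exact: (sep i j).
- exact: (sep j i).
Qed.

(** By [prime_pairs_separated] at most one link of the chain becomes an equality in [K]. *)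
Lemma preim_chain n :
  has_prime_chain W n.+1 -> has_prime_chain (iota @^-1` W) n.
Proof.
move=> [P [pP ltP]].
have leP i j : (i <= j)%N -> (j <= n.+1)%N -> P i `<=` P j.
  elim: j => [|j IH]; first by rewrite leqn0 => /eqP -> _ x.
  rewrite leq_eqVlt => /orP[/eqP -> _ x //|]; rewrite ltnS => ij jn.
  by apply: subset_trans (IH ij (ltnW jn)) _; case: (ltP _ jn).
have sepE i : (i <= n)%N -> separated (P i) (P i.+1) ->
    iota @^-1` (P i) `<` iota @^-1` (P i.+1).
  move=> i_n [z [z' nz]]; split=> [x|/(_ z z')//].
  by apply: leP.
have sep2 i j : (i < j)%N -> (j <= n)%N ->
    separated (P i) (P i.+1) \/ separated (P j) (P j.+1).
  move=> ij jn; have i_n := ltn_trans ij (_ : j < n.+1)%N.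
  apply: prime_pairs_separated; try by apply: pP; lia.
  - by apply: ltP; lia.
  - by apply: leP; lia.
  - exact: ltP.
have [[i0 [i0n nsep]]|allsep] :=
  pselect (exists i, (i <= n)%N /\ ~ separated (P i) (P i.+1)); last first.
  (* No link collapses, and the top prime is left out. *)
  exists (fun i => iota @^-1` (P i)); split=> i i_n.
    by apply: preim_prime; apply: pP; lia.
  apply: sepE; first exact: ltnW.
  by apply: contrapT => nsep; apply: allsep; exists i; split=> //; apply: ltnW.
(* The index [i0.+1] is omitted. If [i0 < n], the new link joins [P i0] to [P i0.+2] and is strict
   because the one above the collapsed link is. *)
pose skip i := if (i <= i0)%N then i else i.+1.
have sep i : (i <= n)%N -> i != i0 -> separated (P i) (P i.+1).
  move=> i_n; rewrite neq_ltn => /orP[lt_i|lt_i].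
    by have [|/nsep] := sep2 _ _ lt_i i0n.
  by have [/nsep|] := sep2 _ _ lt_i i_n.
exists (fun i => iota @^-1` (P (skip i))); split=> i i_n.
  by apply: preim_prime; apply: pP; rewrite /skip; case: ifP; lia.
rewrite /skip; case: (ltngtP i i0) => [lt_i|lt_i|eq_i].
- by apply: sepE; [lia|apply: sep; [lia|rewrite neq_ltn lt_i]].
- by apply: sepE; [lia|apply: sep; [lia|rewrite neq_ltn (leq_trans lt_i) ?orbT]].
- have i1_n : (i.+1 <= n)%N by lia.
  have [|sub nsub] := sepE i.+1 i1_n; first by apply: sep => //; apply/eqP; lia.
  split=> [x Px|le]; first by apply: sub; apply: leP Px; lia.
  by apply: nsub => x /le; apply: leP; lia.
Qed.

End DimensionInequality.

(** * The composite of the X-adic valuation with a valuation of K *)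

Section CompositeValuation.
Variable D : idomainType.
Local Notation K := {fraction D}.
Local Notation D1 := {poly D}.
Local Notation K1 := {fraction {poly D}}.
Implicit Types (S V P : set K).

(** The rational functions regular at 0 with value there in [S]. [S] is any set, so that one formula
    gives both the composite valuation ring and its primes. *)
Definition value0_in S : set K1 :=
  [set x | exists p q : D1,
     [/\ q`_0 != 0, x = p%:F / q%:F & S ((p`_0)%:F / (q`_0)%:F)]].

Lemma coef0_neq0 (q : D1) : q`_0 != 0 -> q != 0.
Proof. by apply: contra_neq => ->; rewrite coef0. Qed.

(** The value at 0 does not depend on the fraction chosen: compare constant coefficients after
    cross-multiplying. *)
Lemma value0_inP S (p q : D1) : q`_0 != 0 ->
  value0_in S (p%:F / q%:F) <-> S ((p`_0)%:F / (q`_0)%:F).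
Proof.
move=> q0; split=> [[p' [q' [q'0 /eq_divF e]]]|Spq]; last by exists p, q.
have /(congr1 (fun r : D1 => r`_0)) := e (coef0_neq0 q0) (coef0_neq0 q'0).
by rewrite /= !coef0M => /(eq_divF _ _ q0 q'0) <-.
Qed.

Lemma value0_in_mono S S' : S `<=` S' -> value0_in S `<=` value0_in S'.
Proof. by move=> SS' x [p [q [q0 -> Spq]]]; exists p, q; split=> //; apply: SS'. Qed.

Lemma value0_inD S x y : (forall u v, S u -> S v -> S (u + v)) ->
  value0_in S x -> value0_in S y -> value0_in S (x + y).
Proof.
move=> SD [p [q [q0 -> Sx]]] [p' [q' [q'0 -> Sy]]].
have [qn q'n] := (coef0_neq0 q0, coef0_neq0 q'0).
exists (p * q' + p' * q), (q * q'); rewrite coefD !coef0M mulf_neq0 //.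
split=> //; first by rewrite addf_div ?tofrac_eq0 // tofracD !tofracM.
by rewrite tofracD !tofracM -addf_div ?tofrac_eq0 //; apply: SD.
Qed.

Lemma value0_inM S S' T x y : (forall u v, S u -> S' v -> T (u * v)) ->
  value0_in S x -> value0_in S' y -> value0_in T (x * y).
Proof.
move=> SM [p [q [q0 -> Sx]]] [p' [q' [q'0 -> Sy]]].
exists (p * p'), (q * q'); rewrite !coef0M mulf_neq0 //.
split=> //; first by rewrite mulf_div !tofracM.
by rewrite !tofracM -mulf_div; apply: SM.
Qed.

Lemma value0_in_poly S (p : D1) : value0_in S p%:F <-> S (p`_0)%:F.
Proof.
have c1 : (1 : D1)`_0 != 0 by rewrite coef1 oner_neq0.
have := value0_inP S p c1.
by rewrite coef1 !tofrac1 !divr1.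
Qed.

Section Valuation.
Variable V : set K.
Hypothesis ovV : valuation_overring V.
Let valV : valuation_ring V := ((valuation_overringP V).1 ovV).2.

Lemma value0_in_valuation : valuation_overring (value0_in V).
Proof.
have DV a : V a%:F by have [+ _] := (valuation_overringP V).1 ovV; apply; exists a.
apply/valuation_overringP; split; first by move=> _ [p _ <-]; apply/value0_in_poly.
split.
  split.
  - by rewrite inE -tofrac1; apply/value0_in_poly; apply: DV.
  - move=> x y; rewrite !inE => Wx Wy; rewrite -[- y]mulN1r.
    apply: value0_inD => //; first exact: vringD.
    apply: value0_inM Wy; first exact: (@vringM _ _ valV).
    by rewrite -tofrac1 -tofracN; apply/value0_in_poly; apply: DV.
  - by move=> x y; rewrite !inE; apply: value0_inM; exact: vringM.
move=> x; have [p [q [q0 ->]]] := fracP x.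
rewrite mulf_eq0 negb_or invr_eq0 !tofrac_eq0 => /andP[p0 _].
(* Powers of X are split off numerator and denominator. If the exponents differ, [x] or its inverse
   vanishes at 0; if they agree, totality of [V] decides. *)
have factor (r : D1) : r != 0 -> exists (k : nat) (s : D1), s`_0 != 0 /\ r = s * 'X^k.
  move=> r0; have [k [s + ->]] := multiplicity_XsubC r 0.
  by rewrite r0 subr0 /= /root horner_coef0 => s0; exists k, s.
have [k [p' [p'0 ->]]] := factor _ p0; have [l [q' [q'0 ->]]] := factor _ q0.
have main (r s : D1) m : r`_0 != 0 -> s`_0 != 0 ->
    value0_in V ((r * 'X^(m.+1))%:F / s%:F).
  by move=> r0 s0; apply/value0_inP => //; rewrite coefMXn /= tofrac0 mul0r; apply: vring0.
have cancelX (r s : D1) a b : (a <= b)%N ->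
    (r * 'X^b)%:F / (s * 'X^a)%:F = (r * 'X^(b - a))%:F / s%:F :> K1.
  move=> ab; have Xn0 : ('X^a)%:F != 0 :> K1 by rewrite tofrac_eq0 -size_poly_eq0 size_polyXn.
  by rewrite -{1}(subnK ab) exprD mulrA !(tofracM _ 'X^a) -mulf_div divff // mulr1.
have [lt_kl|lt_lk|->] := ltngtP k l.
- right; rewrite invf_div cancelX 1?ltnW // -(@prednK (l - k)) ?subn_gt0 //.
  exact: main.
- left; rewrite cancelX 1?ltnW // -(@prednK (k - l)) ?subn_gt0 //.
  exact: main.
rewrite invf_div !cancelX // subnn !mulr1 !value0_inP // -[X in _ \/ V X]invf_div.
by apply: vring_total => //; rewrite mulf_neq0 ?invr_eq0 ?tofrac_eq0.
Qed.

Lemma value0_in_prime P :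
  prime_ideal V P -> prime_ideal (value0_in V) (value0_in P).
Proof.
move=> [[PV P0 PD PM] P1 Pp]; split; [split|..].
- exact: value0_in_mono.
- by rewrite -tofrac0; apply/value0_in_poly; rewrite coef0 tofrac0.
- by move=> x y; apply: value0_inD.
- by move=> x y; apply: value0_inM.
- by rewrite -tofrac1 => /value0_in_poly; rewrite coef1 tofrac1.
- move=> x y [p [q [q0 -> Vx]]] [p' [q' [q'0 -> Vy]]].
  rewrite mulf_div -!tofracM !value0_inP ?coef0M ?mulf_neq0 //.
  by rewrite !tofracM -mulf_div; apply: Pp.
Qed.

Lemma value0_in_chain n :
  has_prime_chain V n -> has_prime_chain (value0_in V) n.+1.
Proof.
move=> [P [pP ltP]]; have [_ valW] := (valuation_overringP _).1 value0_in_valuation.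
(* The extra link is at the bottom, and strict because X vanishes at 0; constants show that the
   other links stay strict. *)
exists (fun i => if i is j.+1 then value0_in (P j) else [set 0]).
split=> -[|i] lt_i.
- split=> [|/eqP|x y _ _ /eqP]; last 2 first.
  + by rewrite oner_eq0.
  + by rewrite mulf_eq0 => /orP[]/eqP ->; [left|right].
  split=> // [_ ->|x y -> ->|a x _ ->]; rewrite ?addr0 ?mulr0 //.
  exact: vring0 valW.
- by apply: value0_in_prime; apply: pP.
- have [[_ P0 _ _] _ _] := pP 0 isT; split.
    by move=> _ ->; rewrite -tofrac0; apply/value0_in_poly; rewrite coef0 tofrac0.
  move=> /(_ 'X%:F) /= X0; have /eqP : 'X%:F = 0 :> K1.
    by apply: X0; apply/value0_in_poly; rewrite coefX tofrac0.
  by rewrite tofrac_eq0 polyX_eq0.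
- have [PP nPP] := ltP i lt_i; split; first exact: value0_in_mono.
  move=> le; apply: nPP => x; have [a [b [b0 ->]]] := fracP x => Px.
  have := le ((a%:P)%:F / (b%:P)%:F).
  by rewrite !value0_inP ?coefC //; apply.
Qed.

Lemma contraction_center_value0 : contraction (center (value0_in V)) = center V.
Proof.
have Vinv d : d != 0 -> value0_in V (d%:P)%:F^-1 <-> V d%:F^-1.
  move=> d0; have := @value0_inP V 1%:P d%:P.
  by rewrite !coefC /= polyC1 !tofrac1 !div1r; apply.
apply/seteqP; split=> d; rewrite /contraction /center /nonunits /=.
all: have [->|d0] := eqVneq d 0; first by left; rewrite ?polyC0 ?tofrac0.
all: rewrite Vinv // => -[/eqP|]; last by right.
all: by rewrite tofrac_eq0 ?polyC_eq0 (negPf d0).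
Qed.

End Valuation.
End CompositeValuation.

(** * Chain lengths for one indeterminate *)

Section PolynomialDimension.
Variables (D : idomainType) (star : set {fraction D} -> set {fraction D}).
Hypothesis semi : is_semistar star.

(** Tracing on K loses at most one link, and composing with the X-adic valuation adds one; both
    passages preserve the center on [D]. *)
Lemma has_star_chain_poly n :
  has_star_chain (star_poly star) n.+1 <-> has_star_chain (star_tilde star) n.
Proof.
split=> -[V].
  move=> /(star_poly_valuation_overringP semi)[oV goodV] cV.
  exists (@constF D @^-1` V).
    apply/star_tilde_valuation_overringP => //.
    by rewrite center_constF_preim; split=> //; apply: constF_preim_valuation.
  apply: preim_chain cV; first exact: algebraic_dependence.
  by case/valuation_overringP: oV.
move=> /(star_tilde_valuation_overringP semi)[oV goodV] cV.
exists (value0_in V); last exact: value0_in_chain.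
apply/star_poly_valuation_overringP => //.
by rewrite contraction_center_value0; split=> //; apply: value0_in_valuation.
Qed.

(** The field K itself qualifies, since its center is zero and contains no nonzero [F]. This gives
    the lower bound that makes the later subtraction exact. *)
Lemma has_star_chain_tilde0 : has_star_chain (star_tilde star) 0.
Proof.
have oT : valuation_overring (@setT {fraction D}).
  by split=> //; [split=> [|x y|x y]; rewrite !inE|left].
exists setT; last first.
  exists (fun=> nonunits setT); split=> // i _.
  by apply: nonunits_prime; case/valuation_overringP: oT.
apply/star_tilde_valuation_overringP => //; split=> // -[F [[[x Fx x0] _] FM] _].
by have [d [d0|/(_ Logic.I)//] dx] := FM _ Fx; rewrite -dx d0 eqxx in x0.
Qed.

End PolynomialDimension.

(** * Induction on the number of indeterminates *)

Section IteratedPolynomials.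
Variables (D : idomainType) (star : set {fraction D} -> set {fraction D}).
Hypothesis semi : is_semistar star.

Lemma star_iter_poly_semistar r : is_semistar (star_iter_poly star r).
Proof. by elim: r => [//|r IH]; apply: star_poly_semistar. Qed.

(** The induction starts at one indeterminate because [star_tilde_star_poly] removes the tilde only
    from operations of the form [star_poly]. *)
Lemma has_star_chain_iter_poly r n :
  has_star_chain (star_iter_poly star r.+1) (n + r.+1) <->
  has_star_chain (star_tilde star) n.
Proof.
elim: r => [|r IH]; first by rewrite addn1; apply: has_star_chain_poly.
rewrite addnS; have semi_r := star_iter_poly_semistar r.
have -> := has_star_chain_poly (star_iter_poly_semistar r.+1) (n + r.+1).
rewrite -IH; split=> -[V sV cV]; exists V => //;
  by apply/(star_tilde_star_poly semi_r).
Qed.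

Lemma star_dimv_eq_iter_poly r k :
  star_dimv_eq (star_iter_poly star r.+1) k <->
  exists2 n, star_dimv_eq (star_tilde star) n & k = (n + r.+1)%N.
Proof.
split=> [/star_dimv_eqP[ck le_k]|[n /star_dimv_eqP[cn le_n] ->]].
  have r_k : (r.+1 <= k)%N.
    by apply: le_k; apply/(has_star_chain_iter_poly r 0)/has_star_chain_tilde0.
  exists (k - r.+1)%N; last by rewrite subnK.
  apply/star_dimv_eqP; split; first by apply/(has_star_chain_iter_poly r); rewrite subnK.
  by move=> l /(has_star_chain_iter_poly r)/le_k; rewrite leq_subRL // addnC.
apply/star_dimv_eqP; split; first exact/has_star_chain_iter_poly.
(* Lengths below [r.+1] do not come from a chain for [star_tilde], but satisfy the bound
   trivially. *)
move=> l cl; have [r_l|/ltnW l_r] := leqP r.+1 l; last first.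
  exact: leq_trans l_r (leq_addl _ _).
by rewrite addnC -leq_subLR; apply: le_n; apply/(has_star_chain_iter_poly r); rewrite subnK.
Qed.

End IteratedPolynomials.

(** * Finite and infinite values of the dimension *)

Lemma star_dimvP (D : idomainType) (star : set {fraction D} -> set {fraction D}) n :
  star_dimv_eq star n -> star_dimv star = Some n.
Proof.
move=> dn; apply: xget_unique; first by exists n.
move=> _ [k dk <-]; congr Some; apply/eqP; rewrite eqn_leq.
have [cn le_n] := (star_dimv_eqP star n).1 dn.
have [ck le_k] := (star_dimv_eqP star k).1 dk.
by rewrite le_k ?le_n.
Qed.

Lemma star_dimv_None (D : idomainType) (star : set {fraction D} -> set {fraction D}) :
  (forall n, ~ star_dimv_eq star n) -> star_dimv star = None.
Proof. by move=> nd; apply: xgetPN => _ [n dn _]; apply: (nd n). Qed.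

Theorem theorem4p8 (D : idomainType)
    (star : set {fraction D} -> set {fraction D}) (m : nat)
    (hstar : is_semistar star) (hm : (1 <= m)%N) :
  star_dimv (star_iter_poly star m) = dim_add (star_dimv (star_tilde star)) m.
Proof.
case: m hm => // r _.
have [[n dn]|none] := pselect (exists n, star_dimv_eq (star_tilde star) n).
  rewrite (star_dimvP dn) /=; apply: star_dimvP.
  by apply/star_dimv_eq_iter_poly => //; exists n.
rewrite (star_dimv_None (star := star_tilde star)) => [|n dn]; last by apply: none; exists n.
apply: star_dimv_None => k /(star_dimv_eq_iter_poly hstar)[n dn _].
by apply: none; exists n.
Qed.
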